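(* $330\leq\mathrm{A}_2(7,4)\leq407$.
   Context: $\mathrm{A}_2(7,4)$ is the maximum size of a set of subspaces (of arbitrary dimensions) of $\mathbb{F}_2^7$ with pairwise subspace distance $\mathrm{d}_{\mathrm{S}}(X,Y)=\dim(X+Y)-\dim(X\cap Y)\geq4$. *)

(* Defs.v *)
From HB Require Import structures.
From mathcomp Require Import all_boot all_order all_algebra.
Set Implicit Arguments. Unset Strict Implicit. Unset Printing Implicit Defensive.
Import GRing.Theory.
Local Open Scope ring_scope.

Notation F27 := 'rV['F_2]_7.

(* Subspace distance d_S(X,Y) = dim(X+Y) - dim(X ∩ Y) (a natural number,
   since dim(X ∩ Y) <= dim(X+Y)). *)
Definition subspace_dist (X Y : {vspace F27}) : nat :=
  (\dim (X + Y)%VS - \dim (X :&: Y)%VS)%N.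

Definition subspace_code (d : nat) (C : seq {vspace F27}) : Prop :=
  uniq C /\ pairwise (fun X Y => (d <= subspace_dist X Y)%N) C.

(* Main.v *)
(* Write a_i for the number of codewords of dimension i. Two codewords meet in a subspace of
   small dimension, so codeword planes share no line, and a line contained in a codeword
   solid is contained in no codeword plane. Upper bound: the Cauchy-Schwarz inequality is
   applied to the incidences of codeword solids with the lines not covered by codeword
   planes, once globally (this also takes the codewords of dimension 5 into account, whose
   lines are mostly uncovered when a_3 is large) and once through each point. Orthogonal
   complementation preserves the distance and exchanges a_i with a_(7-i), so one may assume
   a_4 <= a_3; the inequalities and their duals then leave a finite check over the values of
   a_4 and a_5.
   Lower bound: the whole space together with 329 planes pairwise meeting in at most a
   point. *)
From Stdlib Require Import ZArith NArith.
From HB Require Import structures.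
Require Import Defs.
From mathcomp Require Import all_boot all_order all_algebra all_field.
From mathcomp Require Import zify.
Set Implicit Arguments. Unset Strict Implicit. Unset Printing Implicit Defensive.
Import GRing.Theory.

(** * Finiteness of the set of subspaces; counts of points and lines *)

(** Encoding a subspace by its set of vectors makes the type of subspaces finite, so that sets of
    subspaces and sums over them are available. *)
Lemma span_enumK : cancel (fun X : {vspace F27} => [set v | v \in X])
                          (fun A : {set F27} => <<enum A>>%VS).
Proof.
move=> X; apply/vspaceP => v; apply/idP/idP => [|vX].
  by move/(subvP _); apply; apply/span_subvP => u; rewrite mem_enum inE.
by apply: memv_span; rewrite mem_enum inE.
Qed.
HB.instance Definition _ := CanIsCountable span_enumK.
HB.instance Definition _ :=
  isFinite.Build {vspace F27} (pcan_enumP (can_pcan span_enumK)).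

Implicit Types (X Y Z : {vspace F27}) (u v : F27) (C : {set {vspace F27}}).

(** Over F_2 a one-dimensional subspace has a single nonzero vector, which stands for the projective
    point. *)
Definition points X : {set F27} := [set v | (v \in X) && (v != 0%R)].
Definition subspaces k X : {set {vspace F27}} := [set Y | (\dim Y == k) && (Y <= X)%VS].

Lemma card_points X : #|points X| = (2 ^ \dim X).-1.
Proof.
have -> : points X = [set v | v \in X] :\ 0%R.
  by apply/setP => v; rewrite !inE andbC.
have := cardsD1 0%R [set v | v \in X].
by rewrite cardsE card_vspace card_Fp // inE mem0v /= => ->.
Qed.

Lemma dimv_le7 X : \dim X <= 7.
Proof. by have := dimvS (subvf X); rewrite dimvf /dim /= mul1n. Qed.

Lemma dim_capD X Y : \dim (X + Y) + \dim (X :&: Y) = \dim X + \dim Y.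
Proof. exact: dimv_sum_cap. Qed.

Lemma dim_point v : v != 0%R -> \dim <[v]>%VS = 1.
Proof. by move=> v0; rewrite dim_vline v0. Qed.

Lemma F2_cases (a : 'F_2) : a = 0%R \/ a = 1%R.
Proof. by case: a => [[|[|//]] ?]; [left | right]; apply: val_inj. Qed.

Lemma mem_vlineF2 u v : (u \in <[v]>%VS) = (u == 0%R) || (u == v).
Proof.
apply/idP/orP => [/vlineP[a ->]|[] /eqP->]; last exact: memv_line; last exact: mem0v.
by case: (F2_cases a) => ->; rewrite ?scale0r ?scale1r eqxx; [left|right].
Qed.

Lemma dim_join2 u v : u != 0%R -> v != 0%R -> u != v -> \dim (<[u]> + <[v]>)%VS = 2.
Proof.
move=> u0 v0 uv; have := dimv_sum_cap <[u]>%VS <[v]>%VS; rewrite !dim_point //.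
suff -> : (<[u]> :&: <[v]>)%VS = 0%VS by rewrite dimv0 addn0.
apply/eqP; rewrite -subv0; apply/subvP => w; rewrite memv0 memv_cap !mem_vlineF2.
case/andP=> /orP[->//|/eqP->]; by rewrite (negPf u0) (negPf uv).
Qed.

Lemma double_count (I J : finType) (A : {set I}) (B : {set J}) (R : I -> J -> bool) :
  \sum_(i in A) #|[set j in B | R i j]| = \sum_(j in B) #|[set i in A | R i j]|.
Proof.
under eq_bigr do rewrite -sum1_card big_mkcond /=.
under [RHS]eq_bigr do rewrite -sum1_card big_mkcond /=.
transitivity (\sum_(i in A) \sum_(j in B) (R i j : nat)).
  apply: eq_bigr => i _; rewrite [RHS]big_mkcond; apply: eq_bigr => j _.
  by rewrite inE; case: (j \in B) (R i j) => [] [].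
rewrite exchange_big; apply: eq_bigr => j _; rewrite big_mkcond; apply: eq_bigr => i _.
by rewrite inE; case: (i \in A) (R i j) => [] [].
Qed.

(** Flags (line on [v], further point of it) are counted twice: a line has two further points, and
    each point other than [v] spans exactly one line with [v]. *)
Lemma card_lines_on v X : v \in points X ->
  #|[set l in subspaces 2 X | v \in l]| = (2 ^ (\dim X).-1).-1.
Proof.
rewrite inE => /andP[vX v0].
have dX : 0 < \dim X.
  by have : \dim <[v]>%VS <= \dim X; [rewrite dimvS // -memvE | rewrite dim_point].
have := double_count [set l in subspaces 2 X | v \in l] (points X :\ v)
  (fun l u => u \in l).
have -> : \sum_(l in [set l in subspaces 2 X | v \in l])
    #|[set u in points X :\ v | u \in l]| = #|[set l in subspaces 2 X | v \in l]| * 2.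
  rewrite -sum_nat_const; apply: eq_bigr => l; rewrite !inE -andbA => /and3P[/eqP dl lX vl].
  have -> : [set u in points X :\ v | u \in l] = points l :\ v.
    apply/setP => u; rewrite !inE; case ul: (u \in l); rewrite /= ?andbT ?andbF //.
    by rewrite (subvP lX _ ul).
  by have := cardsD1 v (points l); rewrite card_points dl inE vl v0 => -[].
have -> : \sum_(u in points X :\ v) #|[set l in [set l in subspaces 2 X | v \in l] | u \in l]|
   = #|points X :\ v| * 1.
  rewrite -sum_nat_const; apply: eq_bigr => u; rewrite !inE => /and3P[uv uX u0].
  apply/eqP/cards1P; exists (<[v]> + <[u]>)%VS; apply/setP => l; rewrite !inE.
  apply/idP/eqP => [/andP[/andP[/andP[/eqP dl lX] vl] ul]|->].
    apply/esym/eqP; rewrite eqEdim dl dim_join2 // 1?eq_sym // andbT.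
    by rewrite subv_add -!memvE vl.
  rewrite dim_join2 // 1?eq_sym // subv_add -!memvE vX uX /=.
  by rewrite (subvP (addvSl _ _)) ?(subvP (addvSr _ _)) ?memv_line.
have := cardsD1 v (points X); rewrite card_points inE vX v0 /= muln1 add1n => e1 e2.
have e3 : (2 ^ \dim X) = 2 * 2 ^ (\dim X).-1 by rewrite -expnS prednK.
move: e1 e2; rewrite {}e3.
move: (2 ^ _) #|points X :\ v| #|[set l in _ | _]| => r p q; lia.
Qed.

Lemma card_lines X : 3 * #|subspaces 2 X| = (2 ^ \dim X).-1 * (2 ^ (\dim X).-1).-1.
Proof.
have := double_count (subspaces 2 X) (points X) (fun l v => v \in l).
rewrite (eq_bigr (fun=> 3)) => [|l]; last first.
  rewrite !inE => /andP[/eqP dl lX].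
  have -> : [set u in points X | u \in l] = points l.
    apply/setP => u; rewrite !inE; case ul: (u \in l); rewrite /= ?andbT ?andbF //.
    by rewrite (subvP lX _ ul).
  by rewrite card_points dl.
rewrite sum_nat_const => e; rewrite mulnC {}e.
under eq_bigr => v vX do rewrite card_lines_on //.
by rewrite sum_nat_const card_points.
Qed.

(** * Orthogonal complements *)

Definition basis_mx X : 'M['F_2]_(\dim X, 7) := (\matrix_i (vbasis X)`_i)%R.

(** The complement is taken for the standard dot product and may meet [X]. As a kernel it gets its
    dimension from rank-nullity. *)
Definition orth X : {vspace F27} := lker (linfun (mulmxr (basis_mx X)^T%R : F27 -> 'rV_(\dim X))).

Lemma mem_orth v X : reflect (forall x, x \in X -> (v *m x^T = 0)%R) (v \in orth X).
Proof.
rewrite memv_ker lfunE /=; apply: (iffP eqP) => [v0 x /coord_vbasis-> | vX].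
  rewrite raddf_sum mulmx_sumr big1 // => i _.
  rewrite /= linearZ /= -scalemxAr.
  suff -> : (v *m ((vbasis X)`_i)^T = 0)%R by rewrite scaler0.
  have /rowP/(_ i) := v0; rewrite !mxE => e; apply/rowP => j; rewrite ord1 !mxE.
  by rewrite -[RHS]e; apply: eq_bigr => k _; rewrite !mxE.
apply/rowP => i; have /rowP/(_ ord0) := vX _ (vbasis_mem (memt_nth 0%R (vbasis X) (ltn_ord i))).
rewrite [RHS]mxE !mxE => e; rewrite -[RHS]e.
by apply: eq_bigr => k _; rewrite !mxE.
Qed.

Lemma dim_orth X : \dim (orth X) = 7 - \dim X.
Proof.
set f := linfun (mulmxr (basis_mx X)^T%R : F27 -> 'rV_(\dim X)).
have free_b : row_free (basis_mx X).
  apply: inj_row_free => u; rewrite mulmx_sum_row => u0; apply/rowP => i; rewrite mxE.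
  have /freeP := basis_free (vbasisP X); apply.
  by rewrite -[RHS]u0; apply: eq_bigr => j _; rewrite rowK.
have /row_fullP[B BK] : row_full (basis_mx X)^T%R by rewrite /row_full mxrank_tr.
have full : (f @: fullv)%VS = fullv.
  apply/vspaceP => w; rewrite memvf.
  have -> : w = f (w *m B)%R by rewrite lfunE /= -mulmxA BK mulmx1.
  by rewrite memv_img ?memvf.
have := limg_ker_dim f fullv; rewrite full capfv !dimvf /dim /= !mul1n => e.
by have : \dim (orth X) + \dim X = 7 := e; lia.
Qed.

Lemma orthS X Y : (X <= Y)%VS -> (orth Y <= orth X)%VS.
Proof.
move=> XY; apply/subvP => v /mem_orth vY; apply/mem_orth => x xX.
exact/vY/(subvP XY).
Qed.

Lemma orthK : involutive orth.
Proof.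
move=> X; apply/esym/eqP; rewrite eqEdim; apply/andP; split.
  apply/subvP => x xX; apply/mem_orth => v /mem_orth/(_ x xX) e.
  by apply: trmx_inj; rewrite trmx_mul trmxK e trmx0.
by rewrite !dim_orth subKn // dimv_le7.
Qed.

Lemma orthD X Y : orth (X + Y) = (orth X :&: orth Y)%VS.
Proof.
apply/eqP; rewrite eqEsubv subv_cap !orthS ?addvSl ?addvSr //=.
apply/subvP => v /memv_capP[/mem_orth vX /mem_orth vY].
by apply/mem_orth => _ /memv_addP[x xX [y yY ->]]; rewrite linearD /= mulmxDr vX ?vY ?addr0.
Qed.

Lemma orthI X Y : orth (X :&: Y) = (orth X + orth Y)%VS.
Proof. by rewrite -[RHS]orthK orthD !orthK. Qed.

(** Complementation exchanges sum and intersection and replaces a dimension k by 7 - k, which leaves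
    the difference unchanged. *)
Lemma orth_dist X Y : subspace_dist (orth X) (orth Y) = subspace_dist X Y.
Proof.
rewrite /subspace_dist -orthI -orthD !dim_orth.
have := dimv_le7 (X + Y); have := dimvS (addvSl X Y); have := dimvS (capvSl X Y); lia.
Qed.


(** * Codes and the degrees of points and lines *)

Definition is_code C := forall X Y, X \in C -> Y \in C -> X != Y -> 4 <= subspace_dist X Y.
Definition of_dim k C := [set X in C | \dim X == k].

(** The distance is dim X + dim Y - 2 dim(X ∩ Y); this form avoids truncated subtraction. *)
Lemma code_dim C X Y : is_code C -> X \in C -> Y \in C -> X != Y ->
  2 * \dim (X :&: Y) + 4 <= \dim X + \dim Y.
Proof. by move=> cC XC YC XY; have := cC _ _ XC YC XY; rewrite /subspace_dist -dim_capD; lia. Qed.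

Lemma code_orth C : is_code C -> is_code (orth @: C).
Proof.
move=> cC _ _ /imsetP[X XC ->] /imsetP[Y YC ->]; rewrite (inj_eq (can_inj orthK)) => XY.
by rewrite orth_dist cC.
Qed.

Lemma card_orth k C : k <= 7 -> #|of_dim k (orth @: C)| = #|of_dim (7 - k) C|.
Proof.
move=> k7; rewrite -(card_imset _ (can_inj orthK)); apply: eq_card => X.
apply/imsetP/idP => [[Y]|]; rewrite inE => /andP[].
  case/imsetP=> Z ZC -> /eqP dZ ->; rewrite orthK inE ZC /=.
  by have := dimv_le7 Z; move: dZ; rewrite dim_orth; lia.
move=> XC /eqP dX; exists (orth X); rewrite ?orthK // inE imset_f //= dim_orth dX; lia.
Qed.

Definition deg k C v := #|[set X in of_dim k C | v \in X]|.
Definition ldeg k C Z := #|[set X in of_dim k C | (Z <= X)%VS]|.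
Definition uncovered C X := [set l in subspaces 2 X | ldeg 3 C l == 0].

Lemma dim_full : \dim (fullv : {vspace F27}) = 7.
Proof. by rewrite dimvf. Qed.

Lemma card_lines_dim X k : \dim X = k ->
  #|subspaces 2 X| = ((2 ^ k).-1 * (2 ^ k.-1).-1) %/ 3.
Proof. by move=> <-; rewrite -card_lines mulKn. Qed.

Lemma in_of_dim k C X : (X \in of_dim k C) = (X \in C) && (\dim X == k).
Proof. by rewrite inE. Qed.

Lemma double_count_const (I J : finType) (A : {set I}) (B : {set J}) (R : I -> J -> bool) n :
  (forall j, j \in B -> #|[set i in A | R i j]| = n) ->
  \sum_(i in A) #|[set j in B | R i j]| = #|B| * n.
Proof. by move=> h; rewrite double_count (eq_bigr (fun=> n)) // sum_nat_const. Qed.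

Lemma points_in X Y : (X <= Y)%VS -> [set v in points Y | v \in X] = points X.
Proof.
move=> XY; apply/setP => v; rewrite !inE andbC andbA.
by case vX: (v \in X) => //=; rewrite (subvP XY _ vX).
Qed.

Lemma lines_in X Y : (X <= Y)%VS -> [set l in subspaces 2 Y | (l <= X)%VS] = subspaces 2 X.
Proof.
move=> XY; apply/setP => l; rewrite !inE -andbA; congr (_ && _).
by apply/andP/idP => [[]//|lX]; rewrite lX (subv_trans lX XY).
Qed.

Lemma sum_deg k C : \sum_(v in points fullv) deg k C v = #|of_dim k C| * (2 ^ k).-1.
Proof.
apply: double_count_const => X; rewrite in_of_dim => /andP[_ /eqP <-].
by rewrite (points_in (subvf X)) card_points.
Qed.

Lemma sum_ldeg k C : \sum_(l in subspaces 2 fullv) ldeg k C l =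
  #|of_dim k C| * (((2 ^ k).-1 * (2 ^ k.-1).-1) %/ 3).
Proof.
apply: double_count_const => X; rewrite in_of_dim => /andP[_ /eqP dX].
by rewrite lines_in ?subvf // (card_lines_dim dX).
Qed.

Lemma lines_on_in v X Y : (X <= Y)%VS ->
  [set l in [set l in subspaces 2 Y | v \in l] | (l <= X)%VS] =
  [set l in subspaces 2 X | v \in l].
Proof.
move=> XY; apply/setP => l; rewrite !inE; case lX: (l <= X)%VS; rewrite ?andbF //.
by rewrite (subv_trans lX XY) !andbT.
Qed.

Lemma sum_ldeg_on k C v : v \in points fullv ->
  \sum_(l in [set l in subspaces 2 fullv | v \in l]) ldeg k C l = deg k C v * (2 ^ k.-1).-1.
Proof.
move=> v0; rewrite /ldeg double_count /deg -sum_nat_const.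
rewrite [LHS](bigID (fun X => v \in X)) /= [X in _ + X]big1 ?addn0 => [|X /andP[_ vX]]; last first.
  apply/eqP; rewrite cards_eq0 -subset0; apply/subsetP => l; rewrite !inE.
  by case/andP=> /andP[_ vl] /subvP/(_ _ vl); rewrite (negPf vX).
rewrite (eq_bigl (mem [set X in of_dim k C | v \in X])) => [|X]; last by rewrite !inE.
apply: eq_bigr => X; rewrite !inE => /andP[/andP[_ /eqP dX] vX].
rewrite lines_on_in ?subvf // card_lines_on ?dX // inE vX.
by move: v0; rewrite inE => /andP[].
Qed.

Lemma code_uniq C X Y Z : is_code C -> X \in C -> Y \in C -> (Z <= X)%VS -> (Z <= Y)%VS ->
  \dim X + \dim Y < 2 * \dim Z + 4 -> X = Y.
Proof.
move=> cC XC YC ZX ZY h; apply/eqP/negPn/negP => XY.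
have := code_dim cC XC YC XY; have : \dim Z <= \dim (X :&: Y) by rewrite dimvS // subv_cap ZX.
lia.
Qed.

Lemma ldeg3_le1 C l : is_code C -> \dim l = 2 -> ldeg 3 C l <= 1.
Proof.
move=> cC dl; apply/card_le1_eqP => Y X; rewrite !inE.
move=> /andP[/andP[YC /eqP dY] lY] /andP[/andP[XC /eqP dX] lX].
by apply: (code_uniq cC XC YC lX lY); rewrite dX dY dl.
Qed.

(** A line lies in at most one codeword plane, so the sum of [ldeg 3] counts the covered lines. *)
Lemma card_uncovered C (A : {set {vspace F27}}) : is_code C -> A \subset subspaces 2 fullv ->
  #|[set l in A | ldeg 3 C l == 0]| + \sum_(l in A) ldeg 3 C l = #|A|.
Proof.
move=> cC /subsetP Al; rewrite -sum1_card -[RHS]sum1_card big_mkcond [X in _ + X]big_mkcond.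
rewrite [RHS]big_mkcond -big_split; apply: eq_bigr => l _; rewrite inE /=.
have [lA /=|//] := boolP (l \in A); have := Al _ lA; rewrite inE => /andP[/eqP dl _].
by have := ldeg3_le1 cC dl; case: (ldeg 3 C l) => [|[]].
Qed.

Lemma uncovered_total C : is_code C ->
  #|uncovered C fullv| + 7 * #|of_dim 3 C| = 2667.
Proof.
move=> cC; have := card_uncovered cC (subxx _); rewrite sum_ldeg mulnC => ->.
by rewrite (card_lines_dim dim_full).
Qed.

(** Of the 63 lines on [v], each codeword plane on [v] covers three, and none is covered twice. *)
Lemma uncovered_on C v : is_code C -> v \in points fullv ->
  #|[set l in uncovered C fullv | v \in l]| + 3 * deg 3 C v = 63.
Proof.
move=> cC v0; have sub : [set l in subspaces 2 fullv | v \in l] \subset subspaces 2 fullv.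
  by apply/subsetP => l; rewrite !inE => /andP[].
have := card_uncovered cC sub; rewrite sum_ldeg_on // card_lines_on // dim_full mulnC => e.
rewrite -[63]/(2 ^ 6).-1 -e; congr (_ + _).
by apply: eq_card => l; rewrite !inE andbAC.
Qed.

Lemma deg3_le C v : is_code C -> v \in points fullv -> deg 3 C v <= 21.
Proof. by move=> cC v0; have := uncovered_on cC v0; lia. Qed.

Lemma deg2_le1 C v : is_code C -> v \in points fullv -> deg 2 C v <= 1.
Proof.
move=> cC; rewrite inE => /andP[_ v0]; apply/card_le1_eqP => Y X; rewrite !inE !memvE.
move=> /andP[/andP[YC /eqP dY] lY] /andP[/andP[XC /eqP dX] lX].
by apply: (code_uniq cC XC YC lX lY); rewrite dX dY dim_point.
Qed.

Lemma deg2_deg3 C v : is_code C -> v \in points fullv -> 0 < deg 2 C v -> deg 3 C v = 0.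
Proof.
move=> cC; rewrite inE => /andP[_ v0] /card_gt0P[X]; rewrite !inE memvE.
move=> /andP[/andP[XC /eqP dX] lX]; apply/eqP; rewrite cards_eq0 -subset0.
apply/subsetP => Y; rewrite !inE memvE => /andP[/andP[YC /eqP dY] lY].
have XY : X = Y by apply: (code_uniq cC XC YC lX lY); rewrite dX dY dim_point.
by move: dX; rewrite XY dY.
Qed.

(* The points of codeword lines lie on no codeword plane, and every point lies on at
   most 21 of them. *)
Lemma planes_lines_bound C : is_code C -> #|of_dim 3 C| + 9 * #|of_dim 2 C| <= 381.
Proof.
move=> cC; have : \sum_(v in points fullv) (deg 3 C v + deg 2 C v * 21) <= 127 * 21.
  have <- : #|points fullv| = 127 by rewrite card_points dim_full.
  rewrite -sum_nat_const; apply: leq_sum => v v0.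
  have := deg3_le cC v0; have := deg2_le1 cC v0; have := deg2_deg3 cC v0.
  by case: (deg 2 C v) => [|[|//]] h _; [rewrite addn0 | rewrite h].
rewrite big_split -big_distrl /= !sum_deg -[(2 ^ 3).-1]/7 -[(2 ^ 2).-1]/3.
by move: #|of_dim 3 C| #|of_dim 2 C| => a b; lia.
Qed.

(** * Second moments and the Cauchy-Schwarz inequality *)

Lemma card_set_sum (J : finType) (B : {set J}) (P : pred J) :
  #|[set j in B | P j]| = \sum_(j in B) P j.
Proof.
rewrite -sum1_card big_mkcond [RHS]big_mkcond; apply: eq_bigr => j _.
by rewrite inE; case: (j \in B) (P j) => [] [].
Qed.

(** With [R] and [S] equal this turns a second moment of degrees into a sum over ordered pairs of
    codewords, hence over their intersections. *)
Lemma double_count2 (I J K : finType) (A : {set I}) (B : {set J}) (D : {set K})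
    (R : I -> J -> bool) (S : I -> K -> bool) :
  \sum_(i in A) #|[set j in B | R i j]| * #|[set k in D | S i k]| =
  \sum_(j in B) \sum_(k in D) #|[set i in A | R i j && S i k]|.
Proof.
under eq_bigr do rewrite !card_set_sum big_distrlr /=.
rewrite exchange_big; apply: eq_bigr => j _; rewrite exchange_big; apply: eq_bigr => k _.
by rewrite card_set_sum; apply: eq_bigr => i _; rewrite mulnb.
Qed.

Lemma cauchy_schwarz (I : finType) (A : {set I}) (g : I -> nat) :
  (\sum_(i in A) g i) ^ 2 <= #|A| * \sum_(i in A) g i ^ 2.
Proof.
rewrite -(leq_pmul2l (isT : 0 < 2)) -mulnn big_distrlr /= big_distrr /=.
have -> : 2 * (#|A| * \sum_(i in A) g i ^ 2) =
    \sum_(i in A) \sum_(j in A) (g i ^ 2 + g j ^ 2).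
  under [RHS]eq_bigr do rewrite big_split /= sum_nat_const.
  by rewrite big_split /= sum_nat_const -big_distrr /= addnn mul2n.
apply: leq_sum => i _; rewrite big_distrr; apply: leq_sum => j _; exact: nat_Cauchy.
Qed.

Lemma sum_pairs_le (J : finType) (B : {set J}) (h : J -> J -> nat) c d :
  (forall j, j \in B -> h j j <= c) ->
  (forall j k, j \in B -> k \in B -> j != k -> h j k <= d) ->
  \sum_(j in B) \sum_(k in B) h j k <= #|B| * (c + #|B|.-1 * d).
Proof.
move=> hc hd; rewrite -sum_nat_const; apply: leq_sum => j jB.
rewrite (bigD1 j) //= leq_add ?hc //.
have -> : #|B|.-1 = #|B :\ j| by rewrite (cardsD1 j B) jB.
rewrite -sum_nat_const (eq_bigl (mem (B :\ j))) => [|k]; last by rewrite !inE andbC.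
by apply: leq_sum => k; rewrite !inE eq_sym => /andP[jk kB]; apply: hd.
Qed.

Lemma card_lines_le1 X : \dim X <= 2 -> #|subspaces 2 X| <= 1.
Proof.
move=> dX; apply/card_le1_eqP => l m; rewrite !inE => /andP[/eqP dl lX] /andP[/eqP dm mX].
by transitivity X; [|symmetry]; apply/eqP; rewrite eqEdim ?lX ?mX ?dl ?dm.
Qed.

Lemma lines_cap X Y Z : (X <= Z)%VS ->
  [set l in subspaces 2 Z | (l <= X)%VS && (l <= Y)%VS] = subspaces 2 (X :&: Y).
Proof.
move=> XZ; apply/setP => l; rewrite !inE subv_cap -andbA; congr (_ && _).
by case lX: (l <= X)%VS; rewrite ?andbF ?(subv_trans lX XZ).
Qed.

Lemma points_cap X Y Z : (X <= Z)%VS ->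
  [set v in points Z | (v \in X) && (v \in Y)] = points (X :&: Y).
Proof.
move=> XZ; apply/setP => v; rewrite !inE memv_cap.
by case vX: (v \in X); rewrite ?andbF // (subvP XZ _ vX) andbC.
Qed.

(** * The bound from all lines of the space *)

Lemma solid_line_uncovered C l : is_code C -> \dim l = 2 -> 0 < ldeg 4 C l -> ldeg 3 C l = 0.
Proof.
move=> cC dl /card_gt0P[X]; rewrite !inE => /andP[/andP[XC /eqP dX] lX].
apply/eqP; rewrite cards_eq0 -subset0; apply/subsetP => Y; rewrite !inE.
move=> /andP[/andP[YC /eqP dY] lY].
have XY : X = Y by apply: (code_uniq cC XC YC lX lY); rewrite dX dY dl.
by move: dX; rewrite XY dY.
Qed.

(** A solid has 35 lines and two codeword solids share at most one, so each solid contributes at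
    most 35 + (a_4 - 1). *)
Lemma sum_ldeg4_sq C : is_code C ->
  \sum_(l in subspaces 2 fullv) ldeg 4 C l ^ 2 <= #|of_dim 4 C| * (#|of_dim 4 C| + 34).
Proof.
move=> cC; under eq_bigr do rewrite -mulnn; rewrite double_count2.
have [/cards0_eq->|a0] := eqVneq #|of_dim 4 C| 0; first by rewrite big_set0.
apply: leq_trans (@sum_pairs_le _ _ _ 35 1 _ _) _.
- move=> X; rewrite in_of_dim => /andP[_ /eqP dX].
  by rewrite lines_cap ?subvf // capvv (card_lines_dim dX).
- move=> X Y; rewrite !in_of_dim => /andP[XC /eqP dX] /andP[YC /eqP dY] XY.
  rewrite lines_cap ?subvf // card_lines_le1 //.
  by have := code_dim cC XC YC XY; rewrite dX dY; lia.
by rewrite leq_mul2l; apply/orP; right; lia.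
Qed.

Lemma sum_ldeg45 C : is_code C ->
  \sum_(l in subspaces 2 fullv) ldeg 4 C l * ldeg 5 C l <= #|of_dim 4 C| * #|of_dim 5 C|.
Proof.
move=> cC; rewrite double_count2 -sum_nat_const; apply: leq_sum => X.
rewrite in_of_dim => /andP[XC /eqP dX]; rewrite -[leqRHS]muln1 -sum_nat_const.
apply: leq_sum => Y; rewrite in_of_dim => /andP[YC /eqP dY].
rewrite lines_cap ?subvf // card_lines_le1 //.
have XY : X != Y by apply/eqP => e; move: dX; rewrite e dY.
by have := code_dim cC XC YC XY; rewrite dX dY; lia.
Qed.

(** Used to replace the points of small intersections by their lines: one point and no line, or
    three points and one line. *)
Lemma points_lines X : 0 < \dim X <= 2 -> #|points X| = 1 + 2 * #|subspaces 2 X|.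
Proof.
move=> dX; have := card_lines X; rewrite card_points.
have [->|->] : \dim X = 1 \/ \dim X = 2 by lia.
  by rewrite -[(2 ^ 1).-1 * _]/0 -[(2 ^ 1).-1]/1; lia.
by rewrite -[(2 ^ 2).-1 * _]/3 -[(2 ^ 2).-1]/3; lia.
Qed.

(* A codeword plane meets E in a point or a line, so counting the flags (point of E,
   codeword plane) relates the number of planes to the lines of E that they cover. *)
Lemma uncovered_in5 C E : is_code C -> E \in of_dim 5 C ->
  #|of_dim 3 C| <= 341 + #|uncovered C E|.
Proof.
move=> cC; rewrite in_of_dim => /andP[EC /eqP dE].
have lE : subspaces 2 E \subset subspaces 2 fullv.
  by apply/subsetP => l; rewrite !inE subvf andbT => /andP[].
have := card_uncovered cC lE; rewrite (card_lines_dim dE) -[_ %/ _]/155.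
have pE : {subset points E <= points fullv}.
  by move=> v; rewrite !inE memvf => /andP[].
(* At each point of [E] only the uncovered lines inside [E] are kept. With u uncovered and 155 - u
   covered lines in [E], this becomes 3 u + 3 (a_3 + 2 (155 - u)) <= 31 * 63, and 651 - 310 =
   341. *)
have : \sum_(v in points E) #|[set l in uncovered C E | v \in l]| +
   3 * \sum_(v in points E) deg 3 C v <= \sum_(v in points E) 63.
  rewrite big_distrr -big_split /=; apply: leq_sum => v /pE v0.
  rewrite -(uncovered_on cC v0) leq_add2r subset_leq_card //.
  by apply/subsetP => l; rewrite !inE subvf andbT => /andP[/andP[/andP[-> _] ->] ->].
rewrite sum_nat_const card_points dE -[(2 ^ 5).-1]/31
  (@double_count_const _ _ _ _ _ 3); last first.
  move=> l; rewrite !inE => /andP[/andP[/eqP dl lX] _].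
  by rewrite points_in // card_points dl.
have -> : \sum_(v in points E) deg 3 C v =
    #|of_dim 3 C| + 2 * \sum_(l in subspaces 2 E) ldeg 3 C l.
  rewrite /deg /ldeg double_count [X in _ + 2 * X]double_count
    big_distrr -sum1_card -big_split; apply: eq_bigr => X /=.
  rewrite in_of_dim => /andP[XC /eqP dX].
  have -> : [set v in points E | v \in X] = points (X :&: E).
    by apply/setP => v; rewrite !inE memv_cap; case: (v \in E); rewrite ?andbF ?andbT // andbC.
  have -> : [set l in subspaces 2 E | (l <= X)%VS] = subspaces 2 (X :&: E).
    by apply/setP => l; rewrite !inE subv_cap -andbA; congr (_ && _); rewrite andbC.
  apply: points_lines; have XE : X != E by apply/eqP => e; move: dX; rewrite e dE.
  have := code_dim cC XC EC XE; have := dim_capD X E; have := dimv_le7 (X + E).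
  by rewrite dX dE; lia.
rewrite -/(uncovered C E); move: #|uncovered C E| (\sum_(_ in _) _) #|of_dim 3 C| => a b c.
by lia.
Qed.

(* The lines would leave exactly one point h of Y uncovered; but a hyperplane of Y meets
   each line in one or three points, so an even number of its points is covered, and it
   contains h. *)
Lemma partial_spread_hole C Y (S := [set X in of_dim 2 C | (X <= Y)%VS]) :
  is_code C -> 1 < \dim Y -> ~~ odd #|S| -> #|S| * 3 + 1 <> (2 ^ \dim Y).-1.
Proof.
move=> cC dY evS cS.
pose d v := #|[set X in S | v \in X]|.
have d1 v : v \in points Y -> d v <= 1.
  move=> vY; apply: leq_trans (deg2_le1 cC (_ : v \in points fullv)).
    by rewrite subset_leq_card //; apply/subsetP => X; rewrite !inE => /andP[/andP[-> _] ->].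
  by move: vY; rewrite !inE memvf => /andP[].
have sumd H : (H <= Y)%VS -> \sum_(v in points H) d v = \sum_(X in S) #|points (X :&: H)|.
  move=> HY; rewrite /d double_count; apply: eq_bigr => X _; apply: eq_card => v.
  by rewrite !inE memv_cap andbC andbA.
have sumS : \sum_(v in points Y) d v = #|S| * 3.
  rewrite sumd ?subvv // -sum_nat_const; apply: eq_bigr => X.
  by rewrite !inE => /andP[/andP[_ /eqP dX] /capv_idPl ->]; rewrite card_points dX.
have sumc : \sum_(v in points Y) (1 - d v) + #|S| * 3 = #|points Y|.
  rewrite -sumS -big_split -sum1_card; apply: eq_bigr => v vY.
  by rewrite /= subnK ?d1.
have {sumS}sumc1 : \sum_(v in points Y) (1 - d v) = 1.
  by move: sumc; rewrite card_points -cS; lia.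
have [h hY dh] : exists2 h, h \in points Y & d h = 0.
  case: (pickP (fun v => (v \in points Y) && (d v == 0))) => [h /andP[hY /eqP dh]|nh].
    by exists h.
  move: sumc1; rewrite big1 // => v vY; have := nh v; rewrite vY /=; have := d1 _ vY; lia.
have dv v : v \in points Y -> v != h -> d v = 1.
  move=> vY vh; move: sumc1; rewrite (bigD1 h) //= (bigD1 v) ?vY //= dh.
  by have := d1 _ vY; lia.
(* A complement of [h] is a hyperplane of [Y] missing [h], so all its points, an odd number, are
   covered exactly once. *)
pose H := (Y :\: <[h]>)%VS.
have [h0 hYv] : h != 0%R /\ h \in Y by move: hY; rewrite inE => /andP[].
have capl : (Y :&: <[h]>)%VS = <[h]>%VS by apply/capv_idPr; rewrite -memvE.
have dH : (\dim H).+1 = \dim Y.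
  by have := dimv_cap_compl Y <[h]>%VS; rewrite capl dim_point // add1n.
have HY : (H <= Y)%VS by exact: diffvSl.
have hH : h \notin H.
  apply/negP => hH; have : h \in (H :&: <[h]>)%VS by rewrite memv_cap hH memv_line.
  by rewrite capv_diff memv0 (negPf h0).
have := sumd _ HY; rewrite (eq_bigr (fun=> 1)) => [|v]; last first.
  rewrite inE => /andP[vH v0]; apply: dv; first by rewrite inE v0 (subvP HY _ vH).
  by apply: contraNneq hH => <-.
rewrite sum1_card card_points.
rewrite (eq_bigr (fun X => 1 + 2 * #|subspaces 2 (X :&: H)|)) => [|X]; last first.
  rewrite !inE => /andP[/andP[_ /eqP dX] XY]; apply: points_lines.
  have := dim_capD X H; have : \dim (X + H) <= \dim Y by rewrite dimvS // subv_add XY.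
  have := dimvS (capvSl X H); rewrite dX -dH; lia.
rewrite big_split sum1_card -big_distrr /=.
have -> : 2 ^ \dim H = 2 * 2 ^ (\dim H).-1 by rewrite -expnS prednK // -ltnS dH.
have := expn_gt0 2 (\dim H).-1; move: evS (2 ^ _) => evS q /= q0.
move=> /(congr1 odd); rewrite oddD (negPf evS) oddM /=.
by case: q q0 => // q _; rewrite mulnS /= oddM.
Qed.

(** Codeword lines are disjoint and [Y] has 31 points, so there are at most 10; ten would leave a
    single hole. *)
Lemma partial_spread_le9 C Y : is_code C -> \dim Y = 5 ->
  #|[set X in of_dim 2 C | (X <= Y)%VS]| <= 9.
Proof.
move=> cC dY; set S := [set X in _ | _].
have : \sum_(v in points Y) #|[set X in S | v \in X]| <= \sum_(v in points Y) 1.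
  apply: leq_sum => v vY; apply: leq_trans (deg2_le1 cC (_ : v \in points fullv)).
    by rewrite subset_leq_card //; apply/subsetP => X; rewrite !inE => /andP[/andP[-> _] ->].
  by move: vY; rewrite !inE memvf => /andP[].
rewrite sum1_card card_points dY (@double_count_const _ _ _ _ _ 3) => [|X]; last first.
  by rewrite !inE => /andP[/andP[_ /eqP dX] XY]; rewrite points_in // card_points dX.
rewrite -[(2 ^ 5).-1]/31 => le31; rewrite leqNgt; apply/negP => S10.
have {le31}{}S10 : #|S| = 10 by lia.
by apply: (@partial_spread_hole C Y); rewrite // ?dY // -/S S10.
Qed.

(** [planes_lines_bound] leaves at most 42 lines, and 42 would cover all but one of the 127
    points. *)
Lemma card_lines_le41 C : is_code C -> #|of_dim 2 C| <= 41.
Proof.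
move=> cC; have := planes_lines_bound cC => le42; rewrite leqNgt; apply/negP => h.
have {le42}{}h : #|of_dim 2 C| = 42 by move: #|of_dim 3 C| le42 h; lia.
have e : [set X in of_dim 2 C | (X <= fullv)%VS] = of_dim 2 C.
  by apply/setP => X; rewrite inE subvf andbT.
by apply: (@partial_spread_hole C fullv); rewrite // ?e ?dim_full ?h.
Qed.

(** By duality these codewords become codeword lines inside the 5-space [orth l]. *)
Lemma ldeg5_le9 C l : is_code C -> \dim l = 2 -> ldeg 5 C l <= 9.
Proof.
move=> cC dl; have dol : \dim (orth l) = 5 by rewrite dim_orth dl.
apply: leq_trans (partial_spread_le9 (code_orth cC) dol).
rewrite /ldeg -(card_imset _ (can_inj orthK)) subset_leq_card //.
apply/subsetP => Z /imsetP[X]; rewrite !inE => /andP[/andP[XC /eqP dX] lX] ->.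
by rewrite imset_f //= dim_orth dX orthS.
Qed.

(** Here n is the number of lines lying in codeword solids. Cauchy-Schwarz gives (35 a_4)^2 <= n a_4
    (a_4 + 34). For the second inequality [uncovered_in5] is summed over the codewords of dimension
    5: the n lines contribute at most a_4 a_5 in all, and each of the other 2667 - 7 a_3 - n
    uncovered lines at most 9. *)
Lemma line_bound C : is_code C ->
  exists2 n, 1225 * #|of_dim 4 C| <= n * (#|of_dim 4 C| + 34) &
    #|of_dim 5 C| * #|of_dim 3 C| + 9 * n + 63 * #|of_dim 3 C| <=
    (341 + #|of_dim 4 C|) * #|of_dim 5 C| + 9 * 2667.
Proof.
move=> cC; set a := #|of_dim 4 C|; pose F := [set l in subspaces 2 fullv | 0 < ldeg 4 C l].
have FU : F \subset uncovered C fullv.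
  apply/subsetP => l; rewrite !inE => /andP[/andP[/eqP dl ->] f0].
  by rewrite dl (solid_line_uncovered cC dl f0).
exists #|F|.
  have [->|a0] := posnP a; first by rewrite muln0.
  have sF (g : nat -> nat) : g 0 = 0 ->
      \sum_(l in F) g (ldeg 4 C l) = \sum_(l in subspaces 2 fullv) g (ldeg 4 C l).
    move=> g0; rewrite (eq_bigl (fun l => (l \in subspaces 2 fullv) && (0 < ldeg 4 C l))).
      by rewrite big_mkcondr; apply: eq_bigr => l _; case: (ldeg 4 C l).
    by move=> l; rewrite inE.
  have := cauchy_schwarz F (ldeg 4 C); rewrite (sF id) // (sF (expn^~ 2)) //.
  rewrite sum_ldeg -/a -[_ %/ _]/35 => cs.
  have := leq_trans cs (leq_mul (leqnn _) (sum_ldeg4_sq cC)); rewrite -/a.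
  rewrite -(leq_pmul2l a0); move: #|F|; nia.
have : #|of_dim 5 C| * #|of_dim 3 C| <=
    341 * #|of_dim 5 C| + \sum_(l in uncovered C fullv) ldeg 5 C l.
  rewrite [341 * _]mulnC -!sum_nat_const /ldeg double_count -big_split.
  apply: leq_sum => E EC; apply: leq_trans (uncovered_in5 cC EC) _.
  rewrite leq_add2l subset_leq_card //; apply/subsetP => l; rewrite !inE.
  by rewrite subvf => /andP[/andP[-> ->] ->].
have : \sum_(l in uncovered C fullv) ldeg 5 C l + 9 * #|F| <=
    a * #|of_dim 5 C| + 9 * #|uncovered C fullv|.
  rewrite (big_setID F) /= (setIidPr FU)
    -[#|uncovered _ _|](cardsID F) (setIidPr FU) mulnDr addnCA.
  rewrite -addnA [9 * _ + _]addnC addnA leq_add2r leq_add //.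
    apply: leq_trans (sum_ldeg45 cC); rewrite [leqRHS](big_setID F) /=.
    rewrite (setIidPr _) ?(subset_trans FU) //; last first.
      by apply/subsetP => l; rewrite inE => /andP[].
    apply: leq_trans (leq_addr _ _); apply: leq_sum => l; rewrite inE => /andP[_ f0].
    by rewrite leq_pmull.
  rewrite mulnC -sum_nat_const; apply: leq_sum => l.
  rewrite !inE => /andP[_ /andP[/andP[/eqP dl _] _]]; exact: ldeg5_le9.
have := uncovered_total cC; rewrite mulnDl.
move: #|uncovered _ _| #|F| (a * _) (#|of_dim 5 C| * _) (\sum_(_ in _) _) => u n p q s.
by move: #|of_dim 3 C| #|of_dim 5 C|; lia.
Qed.

(** * The bound from the lines through each point *)

(** Each of the 7 points of [X] lies on at most 20 further codeword planes. *)
Lemma plane_neighbours C X : is_code C -> X \in of_dim 3 C ->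
  \sum_(Y in of_dim 3 C :\ X) #|points (X :&: Y)| <= 140.
Proof.
move=> cC X3; have := X3; rewrite in_of_dim => /andP[XC /eqP dX].
have -> : \sum_(Y in of_dim 3 C :\ X) #|points (X :&: Y)| =
    \sum_(v in points X) #|[set Y in of_dim 3 C :\ X | v \in Y]|.
  rewrite double_count; apply: eq_bigr => Y _; apply: eq_card => v.
  by rewrite !inE memv_cap andbAC.
have <- : \sum_(v in points X) 20 = 140 by rewrite sum_nat_const card_points dX.
apply: leq_sum => v; rewrite inE => /andP[vX v0].
rewrite -ltnS; apply: leq_trans (deg3_le cC (_ : v \in points fullv)); last first.
  by rewrite inE memvf.
rewrite /deg [leqRHS](cardsD1 X) inE X3 vX ltnS subset_leq_card //.
by apply/subsetP => Y; rewrite !inE => /andP[/andP[-> ->] ->].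
Qed.

(* The orthogonal complements of two codeword solids meeting in a line are planes meeting
   in a point. *)
Lemma solid_neighbours C X : is_code C -> X \in of_dim 4 C ->
  #|[set Y in of_dim 4 C :\ X | \dim (X :&: Y) == 2]| <= 140.
Proof.
move=> cC; rewrite in_of_dim => /andP[XC /eqP dX].
have oX : orth X \in of_dim 3 (orth @: C) by rewrite in_of_dim imset_f //= dim_orth dX.
apply: leq_trans (plane_neighbours (code_orth cC) oX).
set S := [set Y in _ | _]; rewrite -(card_imset S (can_inj orthK)) -sum1_card.
have sub : [set orth Y | Y in S] \subset of_dim 3 (orth @: C) :\ orth X.
  apply/subsetP => Z /imsetP[Y]; rewrite !inE => /andP[/andP[YX /andP[YC /eqP dY]] _] ->.
  by rewrite (inj_eq (can_inj orthK)) YX imset_f //= dim_orth dY.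
rewrite [leqRHS](big_setID [set orth Y | Y in S]) /= (setIidPr sub).
apply: leq_trans (leq_addr _ _); apply: leq_sum => Z /imsetP[Y].
rewrite !inE => /andP[/andP[YX /andP[YC /eqP dY]] /eqP dXY] ->.
rewrite card_points -orthD dim_orth.
have := dim_capD X Y; rewrite dXY dX dY => dD.
have -> : \dim (X + Y) = 6 by lia.
by [].
Qed.

(** A solid shares 15 points with itself, and at most one with any other codeword solid, except
    three with at most 140 of them: 15 + (a_4 - 1) + 2 * 140 = a_4 + 294. *)
Lemma sum_deg4_sq C : is_code C ->
  \sum_(v in points fullv) deg 4 C v ^ 2 <= #|of_dim 4 C| * (#|of_dim 4 C| + 294).
Proof.
move=> cC; under eq_bigr do rewrite -mulnn; rewrite double_count2 -sum_nat_const.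
apply: leq_sum => X X4; have := X4; rewrite in_of_dim => /andP[XC /eqP dX].
rewrite (bigD1 X) //= points_cap ?subvf // capvv card_points dX -[(2 ^ 4).-1]/15.
have cX : #|of_dim 4 C| = 1 + #|of_dim 4 C :\ X| by rewrite (cardsD1 X) X4.
rewrite (eq_bigl (mem (of_dim 4 C :\ X))) => [|Y]; last by rewrite !inE andbC.
have := solid_neighbours cC X4; rewrite card_set_sum.
have : \sum_(Y in of_dim 4 C :\ X)
    #|[set v in points fullv | (v \in X) && (v \in Y)]| <=
  \sum_(Y in of_dim 4 C :\ X) (1 + 2 * (\dim (X :&: Y) == 2)).
  apply: leq_sum => Y; rewrite !inE => /andP[YX /andP[YC /eqP dY]].
  rewrite points_cap ?subvf // card_points; rewrite eq_sym in YX.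
  have := code_dim cC XC YC YX; rewrite dX dY.
  by case: (\dim _) => [|[|[|n]]] //; lia.
rewrite big_split sum1_card -big_distrr cX /=.
by move: (\sum_(Y in of_dim 4 C :\ X) (_ == _)) (\sum_(_ in _) _) #|_ :\ X|; lia.
Qed.

(* Cauchy-Schwarz for the incidences of the N uncovered lines on v with the solids on v:
   two such solids share at most one line on v. *)
Lemma deg4_uncovered C v : is_code C -> v \in points fullv ->
  49 * deg 4 C v <= #|[set l in uncovered C fullv | v \in l]| * (deg 4 C v + 6).
Proof.
move=> cC vp; set F := [set l in _ | _]; set b := deg 4 C v.
have [->|b0] := posnP b; first by [].
pose B := [set X in of_dim 4 C | v \in X]; pose A := [set l in subspaces 2 fullv | v \in l].
have ldegB (l : {vspace F27}) : v \in l -> ldeg 4 C l = #|[set X in B | (l <= X)%VS]|.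
  move=> vl; apply: eq_card => X; rewrite !inE; case lX: (l <= X)%VS; rewrite ?andbF //.
  by rewrite (subvP lX _ vl) !andbT.
(* Lines on [v] covered by a codeword plane lie in no codeword solid, so sums over [F] extend to all
   lines on [v]. *)
have sF (g : nat -> nat) : g 0 = 0 ->
    \sum_(l in F) g (ldeg 4 C l) = \sum_(l in A) g (ldeg 4 C l).
  move=> g0; rewrite [RHS](big_setID F) /= (setIidPr _) => [|]; last first.
    by apply/subsetP => l; rewrite !inE => /andP[/andP[-> _] ->].
  rewrite [X in _ + X]big1 ?addn0 // => l; rewrite !inE subvf !andbT.
  case/andP=> nF /andP[/eqP dl vl]; have [->//|] := posnP (ldeg 4 C l).
  by move/(solid_line_uncovered cC dl)=> e; rewrite dl e vl in nF.
have := cauchy_schwarz F (ldeg 4 C); rewrite (sF id) // (sF (expn^~ 2)) //.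
rewrite sum_ldeg_on // -/b -[(2 ^ 4.-1).-1]/7 => cs.
have sq : \sum_(l in A) ldeg 4 C l ^ 2 <= b * (7 + b.-1 * 1).
  rewrite (eq_bigr (fun l => #|[set X in B | (l <= X)%VS]| * #|[set X in B | (l <= X)%VS]|)).
    rewrite double_count2; apply: sum_pairs_le => [X|X Y]; rewrite !inE.
      move=> /andP[/andP[_ /eqP dX] vX]; apply: (@leq_trans #|[set l in subspaces 2 X | v \in l]|).
        rewrite subset_leq_card //; apply/subsetP => l; rewrite !inE.
        by move=> /andP[/andP[/andP[-> _] ->]] /andP[->].
      rewrite card_lines_on ?dX //; by move: vp; rewrite !inE vX => /andP[].
    move=> /andP[/andP[XC /eqP dX] vX] /andP[/andP[YC /eqP dY] vY] XY.
    apply: leq_trans (card_lines_le1 (_ : \dim (X :&: Y) <= 2)).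
      rewrite subset_leq_card //; apply/subsetP => l; rewrite !inE subv_cap.
      by move=> /andP[/andP[/andP[-> _] _] /andP[-> ->]].
    by have := code_dim cC XC YC XY; rewrite dX dY; lia.
  by move=> l; rewrite inE => /andP[_ vl]; rewrite -mulnn ldegB.
have {cs sq} := leq_trans cs (leq_mul (leqnn _) sq).
have -> : 7 + b.-1 * 1 = b + 6 by lia.
move=> h; rewrite -(leq_pmul2l b0); move: h; rewrite -mulnn.
by move: b b0 #|F| => b _ n; lia.
Qed.

(* Tangent-line form of Cauchy-Schwarz over the points: from M (b + 6) >= 49 b with
   b + 6 replaced by its mean (a + 384) / 15. *)
Lemma tangent_bound (a b M : nat) : 49 * b <= M * (b + 6) ->
  735 * b * (2 * a + 678) <= M * (a + 384) ^ 2 + 735 * 15 * b ^ 2.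
Proof.
move=> h; set K := a + 384.
(* This is 2xy <= x^2 + y^2 for x = K and y = 15 (b + 6), with equality when b + 6 = K / 15. *)
have : 49 * b * (2 * K * (15 * b + 90)) <= 49 * b * (K ^ 2 + (15 * b + 90) ^ 2).
  by rewrite leq_mul2l -mulnA nat_Cauchy orbT.
have : 49 * b * K ^ 2 <= M * (b + 6) * K ^ 2 by rewrite leq_mul2r h orbT.
rewrite -(leq_pmul2r (_ : 0 < b + 6)) ?addn_gt0 ?orbT // /K.
by nia.
Qed.

(** [tangent_bound] is summed over all points. The constant 384 is 294 + 6 * 15: by [sum_deg4_sq]
    the average of [deg 4] plus 6 over incident point-solid pairs is at most (a_4 + 384) / 15. *)
Lemma point_bound C : is_code C ->
  525 * #|of_dim 4 C| + (#|of_dim 3 C| + 2 * #|of_dim 2 C|) * (#|of_dim 4 C| + 384) <=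
  381 * (#|of_dim 4 C| + 384).
Proof.
move=> cC; set a := #|of_dim 4 C|.
pose N v := #|[set l in uncovered C fullv | v \in l]|.
(* On a point of a codeword line all 63 lines are uncovered, while 49 already suffice for 49 b <= M
   (b + 6). Giving up the other 14 brings a_2 into the bound. *)
pose M v := N v - 14 * deg 2 C v.
have NM v : v \in points fullv -> N v = M v + 14 * deg 2 C v /\
    49 * deg 4 C v <= M v * (deg 4 C v + 6).
  move=> vp; have := uncovered_on cC vp; have := deg4_uncovered cC vp.
  have := deg2_le1 cC vp; have := deg2_deg3 cC vp; rewrite -/(N v) /M.
  case: (deg 2 C v) => [|[|//]]; first by rewrite muln0 subn0 addn0.
  move=> d3 _ h; rewrite d3 // => e; have -> : N v = 63 by lia.
  by split=> //; lia.
have sN : \sum_(v in points fullv) M v + 21 * #|of_dim 3 C| + 42 * #|of_dim 2 C| = 3 * 2667.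
  have : \sum_(v in points fullv) N v = #|uncovered C fullv| * 3.
    apply: double_count_const => l; rewrite !inE => /andP[/andP[/eqP dl _] _].
    by rewrite points_in ?subvf // card_points dl.
  rewrite (eq_bigr (fun v => M v + 14 * deg 2 C v)) => [|v /NM[]//].
  rewrite big_split -big_distrr /= sum_deg -[(2 ^ 2).-1]/3.
  have := uncovered_total cC.
  by move: (\sum_(_ in _) _) #|uncovered _ _| #|of_dim 3 C| #|of_dim 2 C|; lia.
have : \sum_(v in points fullv) 735 * deg 4 C v * (2 * a + 678) <=
    \sum_(v in points fullv) (M v * (a + 384) ^ 2 + 735 * 15 * deg 4 C v ^ 2).
  by apply: leq_sum => v /NM[_ h]; apply: tangent_bound.
rewrite big_split -!big_distrl -!big_distrr /= sum_deg -/a -[(2 ^ 4).-1]/15.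
have := sum_deg4_sq cC; rewrite -/a.
have [->|a0] := posnP a.
  by move: sN; move: (\sum_(_ in _) M _) #|of_dim 3 C| #|of_dim 2 C|; lia.
move: sN; move: (\sum_(v in _) M v) (\sum_(v in _) deg 4 C v ^ 2) #|of_dim 3 C| #|of_dim 2 C|.
move: a a0 => a a0 m s a3 a2 e1 e2 e3.
have {e2} e2 : 735 * (a * 15) * (2 * a + 678) <= m * (a + 384) ^ 2 + 735 * 15 * (a * (a + 294)).
  by apply: leq_trans e3 _; rewrite leq_add2l leq_mul2l e2 orbT.
(* Since (2a + 678) - (a + 294) = a + 384, a factor a + 384 cancels. The claim then follows from m =
   21 (381 - a_3 - 2 a_2). *)
have {e2 e3} : 735 * 15 * a <= m * (a + 384).
  rewrite -(leq_pmul2r (_ : 0 < a + 384)) ?addn_gt0 ?orbT //; nia.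
nia.
Qed.

(** * Total size and the finite check *)

Definition low C := [set X in C | \dim X <= 1].

(** Dimensions 6 and 7 are counted in the dual code, so that [card_low] serves both ends. *)
Lemma card_code C : is_code C -> #|C| =
  #|low C| + #|of_dim 2 C| + #|of_dim 3 C| + #|of_dim 4 C| + #|of_dim 5 C| + #|low (orth @: C)|.
Proof.
move=> cC; have -> : #|low (orth @: C)| = #|[set X in C | 6 <= \dim X]|.
  rewrite -[RHS](card_imset _ (can_inj orthK)); apply: eq_card => Z; apply/idP/imsetP.
    rewrite inE => /andP[/imsetP[X XC ->]]; rewrite dim_orth => dX.
    by exists X => //; rewrite inE XC; lia.
  by case=> X; rewrite inE => /andP[XC dX] ->; rewrite inE imset_f //= dim_orth; lia.
rewrite !card_set_sum -sum1_card -!big_split; apply: eq_bigr => X _ /=.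
by case: (\dim X) => [|[|[|[|[|[|n]]]]]].
Qed.

(** The distance is at most the sum of the dimensions, which is below 4 for two low codewords and
    for a low one and a line. *)
Lemma card_low C : is_code C -> #|low C| <= (#|of_dim 2 C| == 0).
Proof.
move=> cC; have low1 : #|low C| <= 1.
  apply/card_le1_eqP => Y X; rewrite !inE => /andP[YC dY] /andP[XC dX].
  by apply/eqP/negPn/negP => XY; have := code_dim cC XC YC XY; lia.
have [//|/card_gt0P[Y]] := posnP #|of_dim 2 C|; rewrite inE => /andP[YC /eqP dY].
rewrite leqn0 cards_eq0 -subset0; apply/subsetP => X; rewrite !inE => /andP[XC dX].
have XY : X != Y by apply/eqP => e; move: dX; rewrite e dY.
by have := code_dim cC XC YC XY; lia.
Qed.

Section Numerics.
Local Open Scope Z_scope.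

(* The dual of point_bound, and line_bound with its n eliminated, for a_3 = b, a_4 = c and
   a_5 = d. *)
Definition feasible (c d b : Z) : bool :=
  (525 * b + (c + 2 * d) * (b + 384) <=? 381 * (b + 384)) &&
  ((c + 34) * ((d + 63) * b) + 11025 * c <=? (c + 34) * ((341 + c) * d + 24003)).

(** The largest a_3 + 2 a_2 that [point_bound] allows when a_4 = c. *)
Definition max_planes (c : Z) : Z := (381 * (c + 384) - 525 * c) / (c + 384).

(* If a_2 + b + c + d + [a_2 = 0] + [d = 0] >= 408, then b is at least b0 or b1, according to
   whether a_2 = 0 or not: the bound b + 2 a_2 <= r gives b >= 2 s - r, and b + 9 a_2 <= 381
   gives 8 b >= 9 s - 381. *)
Definition infeasible (c d : Z) : bool :=
  let s := 408 - c - d - (if d =? 0 then 1 else 0) in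
  let r := max_planes c in
  let b0 := Z.max c (s - 1) in
  let b1 := Z.max c (Z.max (2 * s - r) ((9 * s - 374) / 8)) in
  (381 <? c + 9 * d) ||
    (((r <? b0) || ~~ feasible c d b0) && ((r - 2 <? b1) || ~~ feasible c d b1)).

Lemma infeasible_all :
  List.forallb (fun c => List.forallb (infeasible c) (List.map Z.of_nat (List.seq 0 42)))
    (List.map Z.of_nat (List.seq 0 202)).
Proof. by vm_compute. Qed.

Lemma infeasibleP c d : 0 <= c < 202 -> 0 <= d < 42 -> infeasible c d.
Proof.
move=> hc hd; have memS n k : 0 <= k < Z.of_nat n -> List.In k (List.map Z.of_nat (List.seq 0 n)).
  move=> hk; rewrite -(Z2Nat.id k); last by lia.
  by apply: List.in_map; apply/List.in_seq; lia.
have /List.forallb_forall/(_ c (memS 202%nat c hc)) := infeasible_all.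
by move/List.forallb_forall/(_ d (memS 42%nat d hd)).
Qed.

(** Both conditions bound a nonnegative multiple of b from above, so testing the least possible b is
    enough. *)
Lemma feasible_le c d b b' : 0 <= c -> 0 <= d -> b' <= b -> feasible c d b -> feasible c d b'.
Proof.
move=> c0 d0 bb /andP[/Z.leb_le h1 /Z.leb_le h2]; apply/andP; split; apply/Z.leb_le.
  have : (c + 2 * d + 144) * b' <= (c + 2 * d + 144) * b by apply: Z.mul_le_mono_nonneg_l; lia.
  lia.
have : ((c + 34) * (d + 63)) * b' <= ((c + 34) * (d + 63)) * b.
  by apply: Z.mul_le_mono_nonneg_l => //; apply: Z.mul_nonneg_nonneg; lia.
lia.
Qed.

Lemma numeric_bound (a b c d n : Z) : 0 <= a -> 0 <= b -> 0 <= c <= b -> 0 <= d <= 41 ->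
  b + 9 * a <= 381 -> c + 9 * d <= 381 ->
  525 * c + (b + 2 * a) * (c + 384) <= 381 * (c + 384) ->
  525 * b + (c + 2 * d) * (b + 384) <= 381 * (b + 384) ->
  1225 * c <= n * (c + 34) ->
  d * b + 9 * n + 63 * b <= (341 + c) * d + 24003 ->
  (if a =? 0 then 1 else 0) + a + b + c + d + (if d =? 0 then 1 else 0) <= 407.
Proof.
move=> a0 b0 [c0 cb] [d0 d41] D D' P P' L1 L2; apply/Z.nlt_ge => T.
have fb : feasible c d b.
  apply/andP; split; apply/Z.leb_le; first by lia.
  (* Multiplying by c + 34 eliminates n through 1225 c <= n (c + 34); 11025 is 9 * 1225. *)
  have : (c + 34) * (d * b + 9 * n + 63 * b) <= (c + 34) * ((341 + c) * d + 24003).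
    by apply: Z.mul_le_mono_nonneg_l; lia.
  lia.
(* The range of the computed check comes from [point_bound] together with c <= b. *)
have c201 : c < 202.
  apply/Z.nle_gt => c202.
  have : b * (c + 384) <= 381 * (c + 384) - 525 * c by nia.
  nia.
have rP : b + 2 * a <= max_planes c by apply: Z.div_le_lower_bound; lia.
have : infeasible c d by apply: infeasibleP; lia.
rewrite /infeasible.
set s := 408 - c - d - _; set r := max_planes c in rP *.
have -> : (381 <? c + 9 * d) = false by apply/Z.ltb_ge.
have hs : s <= (if a =? 0 then 1 else 0) + a + b by rewrite /s; lia.
rewrite orFb; case/andP; case: Z.eqb_spec hs => [a00|an0] hs.
  move=> + _; case/orP=> [/Z.ltb_lt|/negP[]]; first by lia.
  by apply: feasible_le fb => //; lia.
(* Since 374 = 381 - 7, the floor is the ceiling of (9 s - 381) / 8. *)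
move=> _; have h8 : (9 * s - 374) / 8 <= b.
  have := Z.mul_div_le (9 * s - 374) 8; lia.
case/orP=> [/Z.ltb_lt|/negP[]]; first by lia.
by apply: feasible_le fb => //; lia.
Qed.
End Numerics.

Theorem code_le407 C : is_code C -> #|C| <= 407.
Proof.
wlog le43 : C / #|of_dim 4 C| <= #|of_dim 3 C| => [hw cC|cC].
  have [/hw/(_ cC)//|lt34] := leqP #|of_dim 4 C| #|of_dim 3 C|.
  rewrite -(card_imset _ (can_inj orthK)); apply: hw (code_orth cC).
  by rewrite !card_orth // ltnW.
have cO := code_orth cC; have [n L1 L2] := line_bound cC.
have := planes_lines_bound cO; have := point_bound cO; have := card_lines_le41 cO.
rewrite !card_orth // -![7 - _]/(_ : nat) => d41 P' D'.
have := card_low cO; rewrite card_orth // -[7 - 2]/5 => low_d.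
have := card_low cC; have := planes_lines_bound cC; have := point_bound cC.
rewrite (card_code cC) => P D low_a.
set a := #|of_dim 2 C| in P D low_a *; set b := #|of_dim 3 C| in P D P' D' L1 L2 le43 *.
set c := #|of_dim 4 C| in P D P' D' L1 L2 le43 *; set d := #|of_dim 5 C| in P' D' L2 d41 low_d *.
have := @numeric_bound (Z.of_nat a) (Z.of_nat b) (Z.of_nat c) (Z.of_nat d) (Z.of_nat n).
clearbody a b c d => num.
suff : (a == 0) + a + b + c + d + (d == 0) <= 407 by lia.
have ea k : (if Z.eqb (Z.of_nat k) 0 then Zpos xH else Z0) = Z.of_nat (k == 0) by case: k.
rewrite !ea in num.
suff : Z.le (Z.of_nat ((a == 0) + a + b + c + d + (d == 0))) 407 by lia.
by rewrite !Nat2Z.inj_add; apply: num; lia.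
Qed.

(** * A code of size 330 *)

(* Found by a local search among the sets of planes invariant under a group of order 16;
   the integers are bit vectors. *)
Definition plane_gens : seq (N * N * N) := [::
   (1,2,12); (1,4,90); (1,6,74); (1,8,18); (1,10,34); (1,16,66); (1,20,36); (1,22,44); (1,24,108);
   (1,28,100); (1,30,98); (1,32,80); (1,38,70); (1,42,64); (1,46,84); (1,50,68); (1,52,92);
   (1,54,72); (1,56,86); (1,60,78); (1,62,88); (2,4,17); (2,5,25); (2,8,53); (2,9,20); (2,16,77);
   (2,24,104); (2,32,73); (2,33,88); (2,36,64); (2,40,89); (2,41,72); (2,44,80); (2,49,84);
   (2,52,65); (2,57,68); (2,60,81); (3,9,48); (3,16,73); (3,17,69); (3,20,41); (3,21,32);
   (3,24,101); (3,28,109); (3,29,104); (3,33,77); (3,36,88); (3,37,93); (3,40,92); (3,44,72);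
   (3,45,76); (3,49,81); (3,52,68); (3,56,65); (3,60,85); (4,8,99); (4,9,67); (4,10,98);
   (4,11,82); (4,16,96); (4,18,105); (4,25,34); (4,26,40); (4,27,43); (4,33,75); (4,35,81);
   (4,41,80); (4,51,66); (4,56,64); (4,57,88); (4,58,73); (5,8,97); (5,9,32); (5,11,48);
   (5,16,104); (5,17,43); (5,18,99); (5,19,34); (5,24,72); (5,26,75); (5,33,65); (5,35,83);
   (5,40,66); (5,42,88); (5,50,89); (5,51,74); (5,56,67); (6,8,113); (6,9,83); (6,10,114);
   (6,11,66); (6,16,106); (6,18,97); (6,25,40); (6,26,34); (6,27,33); (6,35,64); (6,41,65);
   (6,43,91); (6,48,89); (6,50,80); (6,51,72); (6,57,82); (7,8,115); (7,9,35); (7,11,49);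
   (7,16,98); (7,17,33); (7,18,107); (7,19,40); (7,24,64); (7,26,65); (7,32,72); (7,34,82);
   (7,41,67); (7,43,81); (7,50,83); (7,56,73); (7,57,90); (8,16,36); (8,20,64); (8,21,68);
   (8,22,70); (8,23,65); (8,32,69); (8,33,83); (8,34,87); (8,35,67); (8,48,82); (8,49,71);
   (8,50,66); (8,51,85); (9,16,65); (9,17,103); (9,21,102); (9,23,96); (9,33,84); (9,34,70);
   (9,38,68); (9,39,86); (9,49,80); (9,50,64); (9,52,87); (9,53,69); (9,54,66); (9,55,82);
   (10,16,99); (10,17,32); (10,18,68); (10,19,33); (10,20,65); (10,21,96); (10,22,71);
   (10,23,103); (10,36,83); (10,38,67); (10,52,66); (10,54,82); (11,16,64); (11,18,71);
   (11,19,100); (11,21,101); (11,23,97); (11,32,83); (11,33,67); (11,36,81); (11,37,69);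
   (11,38,87); (11,39,65); (11,52,70); (11,55,84); (12,16,39); (12,17,102); (12,18,38);
   (12,19,101); (12,20,33); (12,21,67); (12,22,68); (12,23,66); (12,35,80); (12,36,70);
   (12,48,65); (12,50,71); (12,51,83); (13,16,37); (13,18,33); (13,19,64); (13,20,101);
   (13,21,39); (13,22,99); (13,23,35); (13,34,86); (13,36,82); (13,38,84); (13,48,80); (13,49,70);
   (13,54,81); (13,55,85); (14,16,33); (14,17,97); (14,18,32); (14,19,96); (14,20,66); (14,21,71);
   (14,22,37); (14,23,68); (14,34,84); (14,39,64); (14,52,81); (14,54,85); (14,55,67); (15,16,34);
   (15,18,36); (15,19,67); (15,20,98); (15,21,38); (15,22,100); (15,23,32); (15,33,70);
   (15,35,66); (15,39,68); (15,48,71); (15,49,65); (15,52,84); (15,53,64); (16,32,70); (16,42,68);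
   (17,34,64); (17,35,78); (17,36,71); (17,37,73); (17,39,76); (17,40,65); (17,41,77); (17,44,68);
   (17,45,72); (17,47,79); (18,34,74); (18,35,73); (18,37,65); (18,39,66); (18,40,72); (18,41,75);
   (18,45,67); (18,47,64); (19,32,65); (19,35,68); (19,36,78); (19,37,71); (19,38,75); (19,41,69);
   (19,42,66); (19,44,79); (19,45,70); (19,46,72); (20,32,78); (20,34,68); (20,38,79); (20,39,77);
   (20,44,71); (21,33,64); (21,44,78); (21,45,74); (21,46,77); (21,47,70); (22,36,67); (22,40,64);
   (22,42,74); (22,46,75); (22,47,73); (23,36,75); (23,37,77); (23,38,72); (23,39,67); (23,43,71);
   (24,34,65); (24,35,74); (24,40,73); (24,41,66); (25,32,64); (25,36,77); (25,37,66); (25,39,69);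
   (25,42,73); (25,44,70); (25,45,75); (25,47,78); (26,32,71); (26,33,69); (26,37,74); (26,39,73);
   (26,42,79); (26,43,77); (26,45,64); (26,47,67); (27,34,72); (27,35,79); (27,36,76); (27,37,68);
   (27,38,65); (27,40,67); (27,41,70); (27,44,69); (27,45,77); (27,46,74); (28,33,74); (28,35,65);
   (28,38,78); (28,40,79); (28,41,73); (28,42,70); (28,45,68); (29,32,66); (29,42,75); (29,44,64);
   (29,45,78); (29,46,71); (30,32,74); (30,34,67); (30,35,71); (30,37,72); (30,41,79); (30,43,68);
   (30,46,66); (31,32,68); (31,36,79); (31,37,67); (31,38,74); (31,42,77)
]%num.

Definition vec (k : N) : F27 := (\row_(i < 7) (N.testbit k (N.of_nat i))%:R)%R.

Definition plane_points (p : N * N * N) : seq N :=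
  let: (a, b, c) := p in
  [:: a; b; c; N.lxor a b; N.lxor a c; N.lxor b c; N.lxor a (N.lxor b c)].

Definition plane_of (p : N * N * N) : {vspace F27} :=
  let: (a, b, c) := p in (<[vec a]> + <[vec b]> + <[vec c]>)%VS.

(* An ordered pair of distinct points, that is, a line with two marked points. *)
Definition pair_codes (p : N * N * N) : seq N :=
  [seq (128 * ij.1 + ij.2)%num
    | ij <- [seq (i, j) | i <- plane_points p, j <- plane_points p] & ij.1 != ij.2].

(** Seven distinct nonzero codes below 128 certify that the three generators are independent. *)
Definition wf_plane (p : N * N * N) : bool :=
  uniq (plane_points p) && all (fun k => (0 <? k)%num && (k <? 128)%num) (plane_points p).

Lemma plane_gens_wf : all wf_plane plane_gens.
Proof. by vm_compute. Qed.

(** No code repeats among the 329 * 42, so no two planes share two points. Sorting avoids a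
    quadratic number of comparisons. *)
Lemma plane_gens_codes : sorted N.ltb (sort N.leb (flatten (map pair_codes plane_gens))).
Proof. by vm_compute. Qed.

Lemma vecD a b : vec (N.lxor a b) = (vec a + vec b)%R.
Proof.
apply/rowP => i; rewrite !mxE N.lxor_spec.
by case: (N.testbit a _) (N.testbit b _) => [] []; apply: val_inj.
Qed.

Lemma vec_inj a b : (a < 128)%num -> (b < 128)%num -> vec a = vec b -> a = b.
Proof.
move=> ha hb e; apply: N.bits_inj => t.
have small k : (k < 128)%num -> (7 <= t)%num -> N.testbit k t = false.
  by move=> hk ht; rewrite -(N.mod_small k (2 ^ 7)) // N.mod_pow2_bits_high.
have [ht|ht] := N.le_gt_cases 7 t; first by rewrite !small.
have ht7 : N.to_nat t < 7 by lia.
have /rowP/(_ (Ordinal ht7)) := e; rewrite !mxE /= N2Nat.id.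
by case: (N.testbit a t) (N.testbit b t) => [] [].
Qed.

Lemma mem_plane_of p v : v \in points (plane_of p) ->
  exists2 k, k \in plane_points p & v = vec k.
Proof.
case: p => [[a b] c]; rewrite inE => /andP[/memv_addP[_ /memv_addP[x xa [y yb ->]] [z zc ->]]].
move: xa yb zc; rewrite !mem_vlineF2.
move=> /orP[]/eqP-> /orP[]/eqP-> /orP[]/eqP->; rewrite ?addr0 ?add0r ?eqxx // => _.
- by exists c; rewrite ?inE ?eqxx ?orbT.
- by exists b; rewrite ?inE ?eqxx ?orbT.
- by exists (N.lxor b c); rewrite ?vecD // ?inE ?eqxx ?orbT.
- by exists a; rewrite ?inE ?eqxx ?orbT.
- by exists (N.lxor a c); rewrite ?vecD // ?inE ?eqxx ?orbT.
- by exists (N.lxor a b); rewrite ?vecD // ?inE ?eqxx ?orbT.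
- by exists (N.lxor a (N.lxor b c)); rewrite ?vecD ?addrA // ?inE ?eqxx ?orbT.
Qed.

Lemma vec_in_plane p k : k \in plane_points p -> vec k \in plane_of p.
Proof.
case: p => [[a b] c].
have ha : vec a \in plane_of (a, b, c).
  by rewrite -[vec a]addr0 -[(vec a + 0)%R]addr0 !memv_add ?memv_line ?mem0v.
have hb : vec b \in plane_of (a, b, c).
  by rewrite -[vec b]add0r -[(0 + vec b)%R]addr0 !memv_add ?memv_line ?mem0v.
have hc : vec c \in plane_of (a, b, c).
  by rewrite -[vec c]add0r -[0%R]addr0 !memv_add ?memv_line ?mem0v.
by rewrite /plane_points !inE => /or4P[/eqP->|/eqP->|/eqP->|/or4P[/eqP->|/eqP->|/eqP->|/eqP->]];
   rewrite ?vecD ?rpredD.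
Qed.

Lemma wf_planeP p k : wf_plane p -> k \in plane_points p -> (0 < k < 128)%num.
Proof.
by move=> /andP[_ /allP h] /h /andP[/N.ltb_lt ? /N.ltb_lt ?].
Qed.

(** Three generators give at most 3; seven distinct nonzero vectors force at least 3. *)
Lemma dim_plane_of p : wf_plane p -> \dim (plane_of p) = 3.
Proof.
move=> wf; apply/eqP; rewrite eqn_leq; apply/andP; split.
  case: p wf => [[a b] c] _; rewrite /plane_of.
  have d1 v : \dim <[v]>%VS <= 1 by rewrite dim_vline leq_b1.
  have d2 := leq_trans (dimv_add_leqif <[vec a]> <[vec b]>) (leq_add (d1 _) (d1 _)).
  exact: leq_trans (dimv_add_leqif _ _) (leq_add d2 (d1 _)).
rewrite -(leq_exp2l _ _ (isT : 1 < 2)) -ltnS.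
have : 7 <= #|points (plane_of p)|.
  have /andP[up _] := wf.
  have uv : uniq (map vec (plane_points p)).
    rewrite map_inj_in_uniq // => i j /(wf_planeP wf)[_ hi] /(wf_planeP wf)[_ hj].
    exact: vec_inj.
  have s7 : 7 <= size (map vec (plane_points p)) by case: p {wf up uv} => [[]].
  apply: leq_trans s7 _; rewrite -(card_uniqP uv).
  rewrite subset_leq_card //; apply/subsetP => _ /mapP[k kp ->].
  rewrite inE vec_in_plane //=; apply/eqP => v0.
  have [k0 k128] := wf_planeP wf kp.
  suff e : k = 0%num by rewrite e in k0.
  by apply: vec_inj => //; rewrite v0; apply/rowP => i; rewrite !mxE.
rewrite card_points; lia.
Qed.

(** An intersection of dimension at least 2 has two distinct points, whose ordered pair has a code
    common to both planes. *)
Lemma dist_plane_of p q : wf_plane p -> wf_plane q -> ~~ has (mem (pair_codes p)) (pair_codes q) ->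
  4 <= subspace_dist (plane_of p) (plane_of q).
Proof.
move=> wp wq disj; rewrite /subspace_dist.
have := dim_capD (plane_of p) (plane_of q); rewrite !dim_plane_of //.
suff : \dim (plane_of p :&: plane_of q) <= 1 by lia.
rewrite leqNgt; apply: contra disj => d2.
have : 1 < #|points (plane_of p :&: plane_of q)|.
  by rewrite card_points; move: (leq_pexp2l (isT : 0 < 2) d2); lia.
case/card_gt1P=> u [v [up vp uv]].
have split2 w : w \in points (plane_of p :&: plane_of q) ->
    exists k, [/\ k \in plane_points p, k \in plane_points q & w = vec k].
  rewrite inE memv_cap => /andP[/andP[wP wQ] w0].
  have [|i iP ei] := @mem_plane_of p w; first by rewrite inE wP.
  have [|j jQ ej] := @mem_plane_of q w; first by rewrite inE wQ.
  exists i; split=> //; suff -> : i = j by [].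
  by apply: vec_inj; rewrite -?ei -?ej //; have [] := (wf_planeP wp iP, wf_planeP wq jQ); lia.
have [i [iP iQ ui]] := split2 _ up; have [j [jP jQ vj]] := split2 _ vp.
have ij : i != j by apply: contraNneq uv => ij; rewrite ui vj ij.
have code r : i \in plane_points r -> j \in plane_points r -> (128 * i + j)%num \in pair_codes r.
  move=> ir jr; apply/mapP; exists (i, j) => //; rewrite mem_filter ij /=.
  by apply/allpairsP; exists (i, j).
by apply/hasP; exists (128 * i + j)%num; apply: code.
Qed.

Lemma uniq_flatten_pairwise (S T : eqType) (f : S -> seq T) s :
  uniq (flatten (map f s)) -> pairwise (fun p q => ~~ has (mem (f p)) (f q)) s.
Proof.
elim: s => //= p s IH; rewrite cat_uniq => /and3P[_ dis /IH->]; rewrite andbT.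
apply/allP => q qs; apply: contra dis => /hasP[x xq xp]; apply/hasP; exists x => //.
by apply/flatten_mapP; exists q.
Qed.

Lemma code_of_planes s : all wf_plane s -> uniq (flatten (map pair_codes s)) ->
  subspace_code 4 (fullv :: map plane_of s).
Proof.
move=> wf us.
have pw : pairwise (fun X Y => 4 <= subspace_dist X Y) (fullv :: map plane_of s).
  rewrite pairwise_cons; apply/andP; split.
    (* The whole space is at distance 7 - 3 = 4 from every plane. *)
    apply/allP => _ /mapP[p /(allP wf) wp ->]; rewrite /subspace_dist (addv_idPl (subvf _)).
    by rewrite (capv_idPr (subvf _)) dim_full dim_plane_of.
  rewrite pairwise_map; apply: (@sub_in_pairwise _ wf_plane) wf (uniq_flatten_pairwise us).
  by move=> p q wp wq; apply: dist_plane_of.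
(* A repeated codeword would be at distance 0 from itself. *)
split=> //; apply: pairwise_uniq pw => X.
by rewrite /subspace_dist addvv capvv subnn.
Qed.

Theorem exists_code330 : exists C : seq {vspace F27}, subspace_code 4 C /\ size C = 330.
Proof.
have sz : size (map plane_of plane_gens) = 329 by rewrite size_map.
exists (fullv :: map plane_of plane_gens); split; last exact: (congr1 S sz).
apply: code_of_planes plane_gens_wf _; rewrite -(sort_uniq N.leb).
apply: sorted_uniq plane_gens_codes => [y x z|x]; last exact: N.ltb_irrefl.
by move=> /N.ltb_lt xy /N.ltb_lt yz; apply/N.ltb_lt; apply: N.lt_trans xy yz.
Qed.

(** [pairwise] compares each entry only with later ones; symmetry of the distance covers the other
    order. *)
Lemma is_code_seq (C : seq {vspace F27}) : subspace_code 4 C -> is_code [set X in C].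
Proof.
move=> [uC /(pairwiseP 0%VS) pC] X Y; rewrite !inE => XC YC XY.
have symd : subspace_dist X Y = subspace_dist Y X by rewrite /subspace_dist addvC capvC.
rewrite -(nth_index 0%VS XC) -(nth_index 0%VS YC).
have [lt|lt|e] := ltngtP (index X C) (index Y C).
- by apply: pC; rewrite ?inE ?index_mem.
- rewrite !nth_index // symd -(nth_index 0%VS XC) -[Y in leqRHS](nth_index 0%VS YC).
  by apply: pC; rewrite ?inE ?index_mem.
by move: XY; rewrite -(nth_index 0%VS XC) e nth_index ?eqxx.
Qed.

(* 330 <= A_2(7,4) <= 407, where A_2(7,4) is the maximum size of a subspace
   code in F_2^7 with minimum subspace distance 4: there is such a code of
   size 330, and every such code has size at most 407. *)
Theorem mainTheorem14 :
  (exists C : seq {vspace F27}, subspace_code 4 C /\ size C = 330%N) /\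
  (forall C : seq {vspace F27}, subspace_code 4 C -> (size C <= 407)%N).
Proof.
split=> [|C codeC]; first exact: exists_code330.
have <- : #|[set X in C]| = size C by rewrite cardsE; apply/card_uniqP; case: codeC.
exact/code_le407/is_code_seq.
Qed.
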